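(* Let $0<\alpha<1$, let $q_0>1$ satisfy $\frac1{q_0}=1-\alpha$, and let $\omega\in\mathcal{A}(1,q_0)$, where $\omega:\mathbb{Z}\to(0,\infty)$ is a discrete weight. Then there exist a positive constant $C$, $q_1>q_0$ and $1<p_1<\frac1\alpha$ such that $\frac1{q_1}=\frac1{p_1}-\alpha$ and, for all $x\in l^p_{\omega^p}$, $$\|M_\alpha x\|_{l^q_{\omega^q}}\le C\,\|x\|_{l^p_{\omega^p}},\qquad t\in[0,1),\quad \frac1p=t+\frac{1-t}{p_1},\quad \frac1q=\frac{t}{q_0}+\frac{1-t}{q_1}.$$
   Context: For $m\in\mathbb{Z}$ and $N\in\mathbb{N}=\{0,1,2,\dots\}$, let $S_{m,N}:=\{k\in\mathbb{Z}:|k-m|\le N\}$, with cardinality $|S_{m,N}|=2N+1$. A discrete weight is a function $\omega:\mathbb{Z}\to(0,\infty)$. Weight class: $\omega\in\mathcal{A}(1,q_0)$ means $$\sup_{m\in\mathbb{Z},\,N\in\mathbb{N}}\Bigg(\frac1{|S_{m,N}|}\sum_{k\in S_{m,N}}\omega(k)^{q_0}\Bigg)^{1/q_0}\Bigg(\sup_{k\in S_{m,N}}\frac1{\omega(k)}\Bigg)<\infty.$$ Operator (discrete fractional maximal operator): for a real sequence $x=\{x(k)\}_{k\in\mathbb{Z}}$, $$M_\alpha x(m):=\sup_{N\in\mathbb{N}}\frac{1}{|S_{m,N}|^{1-\alpha}}\sum_{k\in S_{m,N}}|x(k)|,\qquad m\in\mathbb{Z}.$$ Spaces: for $1\le r<\infty$,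 $l^r_{\omega^r}$ is the set of real sequences $x$ with $\|x\|_{l^r_{\omega^r}}:=\big(\sum_{k\in\mathbb{Z}}|x(k)\omega(k)|^r\big)^{1/r}<\infty$. Convention: $C$ denotes a positive constant independent of the main parameters.
   Formalization: The constant C may depend on t (q_1 and p_1 do not); a C uniform over t in [0,1) is impossible, as ω=1 and x=δ_0 show: ‖x‖=1 while ‖M_αx‖_{l^q} tends to infinity as t→1. *)

(* Defs.v *)
From mathcomp Require Import all_boot all_order all_algebra.
From mathcomp Require Import all_classical all_reals all_analysis.
From mathcomp Require Import zify.
Set Implicit Arguments.
Unset Strict Implicit.
Unset Printing Implicit Defensive.
Import Order.TTheory GRing.Theory Num.Theory.
Local Open Scope classical_set_scope.
Local Open Scope ring_scope.

Definition symint (m : int) (N : nat) : set int := [set k | `|k - m| <= N%:Z].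

Lemma card_symint (m : int) (N : nat) : (symint m N #= `I_(2 * N + 1))%card.
Proof.
apply/card_set_bijP; exists (fun k : int => `|(k - m + N%:Z)%R|%N); split.
- by move=> k; rewrite /symint /=; lia.
- by move=> i j; rewrite !inE /symint /=; lia.
- by move=> i; rewrite /symint /= => hi; exists (m - N%:Z + i%:Z) => /=; lia.
Qed.

Lemma finite_symint (m : int) (N : nat) : finite_set (symint m N).
Proof. by exists (2 * N + 1)%N; exact: card_symint. Qed.

Definition discrete_weight (R : realType) (w : int -> R) : Prop :=
  forall k, 0 < w k.

(* Suprema are taken in the extended reals; symint m N has 2N + 1 elements
   (card_symint). *)
Definition A1_char (R : realType) (q : R) (w : int -> R) : \bar R :=
  ereal_sup
    [set (((2 * N + 1)%:R^-1 * \sum_(k \in symint m N) w k `^ q) `^ q^-1)%:E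
         * ereal_sup [set ((w k)^-1)%:E | k in symint m N]
    | m in [set: int] & N in [set: nat]]%E.

Definition A1_weight (R : realType) (q : R) (w : int -> R) : Prop :=
  (A1_char q w < +oo)%E.

(* The value may be +oo when x is not summable enough. *)
Definition frac_max (R : realType) (alpha : R) (x : int -> R) (m : int)
    : \bar R :=
  ereal_sup
    [set (((2 * N + 1)%:R `^ (1 - alpha))^-1
           * \sum_(k \in symint m N) (`|x k| : R))%:E | N in [set: nat]].

(* Norm of l^r_{w^r}, for extended real valued sequences because frac_max is
   such. For r >= 1 and w > 0 it is +oo as soon as one term is infinite. *)
Definition wlnorm (R : realType) (r : R) (w : int -> R) (y : int -> \bar R)
    : \bar R :=
  poweR (\esum_(k in [set: int]) poweR `|y k * (w k)%:E| r)%E r^-1.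

Definition wlspace (R : realType) (r : R) (w : int -> R) : set (int -> R) :=
  [set x | (wlnorm r w (EFin \o x) < +oo)%E].

(* Main.v *)
(* The A_1 condition on w^q0 improves itself to w^q for q slightly larger than
   q0. If u = w^q is A_1, its mean over an interval S is at most K u(k) for k in
   S, which gives
     |S|^(alpha - 1) sum_S f <= K^(1 - alpha) u(S)^alpha A,
   where A is the u-mean over S of f u^(-alpha). Hedberg's trick then bounds the
   q-th power of u(S)^alpha A by the p-th power of A times a constant, so that
   everything reduces to the L^p(u) boundedness of the maximal function
   associated with the measure u. Splitting intervals at their base point leaves
   one-sided maximal functions, for which the rising sun lemma provides the weak
   type inequality without any doubling hypothesis.

   A supremum over intervals is handled by bounds uniform in the choice of one
   interval per point; windows of Z are translated to initial segments of
   nat. *)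
Require Import Defs.
From mathcomp Require Import all_boot all_order all_algebra.
From mathcomp Require Import all_classical all_reals all_analysis.
From mathcomp Require Import zify lra.
Set Implicit Arguments.
Unset Strict Implicit.
Import Order.TTheory GRing.Theory Num.Theory.
Local Open Scope classical_set_scope.
Local Open Scope ring_scope.

(** * Young's inequality for real powers *)

(** Young's inequality for [a] and [b^s] with the conjugate exponents [1 + s] and [(1 + s) / s],
    cleared of denominators. It says that the graph of the power [1 + s] lies above its tangent at
    [b], and replaces differentiation and integration below. *)
Lemma young_powR (R : realType) (s a b : R) : 0 < s -> 0 <= a -> 0 <= b ->
  (1 + s) * (a * b `^ s) <= a `^ (1 + s) + s * b `^ (1 + s).
Proof.
move=> s0 a0 b0; have s1 : 0 < 1 + s by rewrite addr_gt0.
have [sN0 s1N0] : s != 0 /\ 1 + s != 0 by rewrite !gt_eqF.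
have H : (1 + s)^-1 + ((1 + s) / s)^-1 = 1.
  by rewrite invf_div -[X in X + _]mul1r -mulrDl divff.
have := conjugate_powR a0 (powR_ge0 b s) s1 (divr_gt0 s1 s0) H.
rewrite -powRrM (_ : s * ((1 + s) / s) = 1 + s); last by rewrite mulrC divfK.
move=> /(ler_wpM2l (ltW s1)) /le_trans; apply.
rewrite invf_div le_eqVlt; apply/orP; left; apply/eqP.
transitivity ((1 + s) / (1 + s) * (a `^ (1 + s) + s * b `^ (1 + s))); first lra.
by rewrite divff// mul1r.
Qed.

Lemma powR1D (R : realType) (s a : R) : 0 < s -> 0 <= a ->
  a `^ (1 + s) = a * a `^ s.
Proof.
by move=> s0 a0; rewrite powRD ?powRr1// gt_eqF// addr_gt0.
Qed.

(** * Self-improvement of A_1 weights on intervals of naturals *)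

(** The A_1 condition with the length multiplied out and the infimum replaced by an arbitrary point;
    intervals are half-open and of any length. *)
Definition nat_A1 (R : realType) (K : R) (v : nat -> R) : Prop :=
  forall a b i, (a <= i < b)%N -> \sum_(a <= j < b) v j <= K * (b - a)%:R * v i.

(** As a function of [y], the right-hand side has derivative [d (1 + d) y^(d - 1) (S - 3 K n y)],
    nonpositive once [S <= 3 K n y]. Young's inequality at [y] and [z] stands for the integration.
    In the application [n] and [S] are the length and the sum of a half interval. *)
Lemma A1_bellman_decr (R : realType) (K d n S y z : R) :
  0 < d -> 0 <= K * n -> 0 <= y -> y <= z -> S <= 3 * K * n * y ->
  z `^ d * ((1 + d) * S - 3 * K * d * n * z)
    <= y `^ d * ((1 + d) * S - 3 * K * d * n * y).
Proof.
move=> d0 Kn y0 yz hS; have z0 := le_trans y0 yz.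
have hy := powR1D d0 y0; have hz := powR1D d0 z0.
have Y := young_powR d0 y0 z0.
have zy : y `^ d <= z `^ d by apply: ge0_ler_powR => //; exact: ltW.
rewrite hy hz in Y.
have h1 : 0 <= (1 + d) * ((3 * K * n * y - S) * (z `^ d - y `^ d)).
  by rewrite mulr_ge0 ?mulr_ge0 ?subr_ge0// addr_ge0// ltW.
have h2 := ler_wpM2l Kn Y.
lra.
Qed.

(* Bellman function argument: [B x y = y^d ((1 + d) x - 3 K d y)], evaluated at
   the mean [x] and the minimum [y] of the weight, is affine in [x],
   nonincreasing in [y] as long as [x <= 3 K y], and is a multiple of
   [x^(1 + d)] on the diagonal. *)
Lemma A1_bellman (R : realType) (K d : R) (v : nat -> R) (a b : nat) :
  0 < d -> 0 <= K -> (forall i, 0 < v i) -> nat_A1 K v -> (a < b)%N ->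
  exists2 i, (a <= i < b)%N & (forall j, (a <= j < b)%N -> v i <= v j) /\
    (1 + d - 3 * K * d) * \sum_(a <= j < b) v j `^ (1 + d) <=
    v i `^ d * ((1 + d) * \sum_(a <= j < b) v j - 3 * K * d * (b - a)%:R * v i).
Proof.
move=> d0 K0 v0 hv; have [n] := ubnP (b - a)%N.
elim: n a b => // n IH a b hn ab.
have [ab1|ab1] := leqP b a.+1.
  have -> : b = a.+1 by lia.
  exists a; first by lia.
  split=> [j hj|]; first by have -> : j = a by lia.
  rewrite !big_nat1 subSnn (powR1D d0 (ltW (v0 _))).
  lra.
pose m := ((a + b)./2)%N.
have [am mb] : (a < m /\ m < b)%N by rewrite /m; lia.
have [|i1 hi1 [m1 H1]] := IH a m _ am; first by lia.
have [|i2 hi2 [m2 H2]] := IH m b _ mb; first by lia.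
rewrite (big_cat_nat (n := m))/= ?(ltnW am) ?(ltnW mb)//.
rewrite (big_cat_nat (n := m) (F := v))/= ?(ltnW am) ?(ltnW mb)//.
have hba : (b - a)%:R = (m - a)%:R + (b - m)%:R :> R.
  by rewrite -natrD; congr (_%:R); lia.
have sum0 c e : 0 <= \sum_(c <= j < e) v j.
  by apply: sumr_ge0 => j _; exact: ltW.
(* Origin of the factor 3: halving an interval of length 3 leaves a half with a third of the points,
   and this is the worst case. *)
have half (i k l : nat) (S : R) : (a <= i < b)%N -> (b - a <= 3 * (l - k))%N ->
    S <= \sum_(a <= j < b) v j -> S <= 3 * K * (l - k)%:R * v i.
  move=> hi hkl /le_trans; apply; apply: le_trans (hv _ _ _ hi) _.
  apply: ler_wpM2r; first exact: ltW.
  rewrite -mulrA mulrCA; apply: ler_wpM2l => //.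
  by rewrite -natrM ler_nat.
have tot : \sum_(a <= j < b) v j =
    \sum_(a <= j < m) v j + \sum_(m <= j < b) v j.
  by rewrite (big_cat_nat (n := m))/= ?(ltnW am) ?(ltnW mb).
have S1 := sum0 a m; have S2 := sum0 m b.
(* The half with the smaller minimum keeps its bound. On the other half the minimum is lowered to
   the common one by monotonicity, and the two bounds add up because they are affine in the sum and
   the length. *)
case: (leP (v i1) (v i2)) => [i12|/ltW i21].
- exists i1; first by lia.
  split=> [j hj|].
    case: (ltnP j m) => jm; first by apply: m1; lia.
    by apply: le_trans i12 (m2 _ _); lia.
  have hS : \sum_(m <= j < b) v j <= 3 * K * (b - m)%:R * v i1.
    by apply: half; [lia|rewrite /m; lia|rewrite tot lerDr].
  have D := A1_bellman_decr d0 (mulr_ge0 K0 (ler0n _ _)) (ltW (v0 i1)) i12 hS.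
  rewrite mulrDr; apply: le_trans (lerD H1 (le_trans H2 D)) _.
  by rewrite hba; lra.
- exists i2; first by lia.
  split=> [j hj|].
    case: (ltnP j m) => jm; last by apply: m2; lia.
    by apply: le_trans i21 (m1 _ _); lia.
  have hS : \sum_(a <= j < m) v j <= 3 * K * (m - a)%:R * v i2.
    by apply: half; [lia|rewrite /m; lia|rewrite tot lerDl].
  have D := A1_bellman_decr d0 (mulr_ge0 K0 (ler0n _ _)) (ltW (v0 i2)) i21 hS.
  rewrite mulrDr; apply: le_trans (lerD (le_trans H1 D) H2) _.
  by rewrite hba; lra.
Qed.

(** The smallness of [d] keeps the coefficient [1 + d - 3 K d] of the Bellman bound above 1/2. Its
    negative term is dropped, and the A_1 condition at the minimum point bounds the remaining
    sum. *)
Lemma nat_A1_powR (R : realType) (K d : R) (v : nat -> R) :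
  0 < d -> 0 <= K -> 6 * K * d <= 1 -> (forall i, 0 < v i) -> nat_A1 K v ->
  nat_A1 (2 * (1 + d) * K) (fun i => v i `^ (1 + d)).
Proof.
move=> d0 K0 hd v0 hv a b k hk.
have ab : (a < b)%N by lia.
have [i hi [mi]] := A1_bellman d0 K0 v0 hv ab.
set S := \sum_(a <= j < b) v j `^ (1 + d); set T := \sum_(_ <= _ < _) _ => H.
have S0 : 0 <= S by apply: sumr_ge0 => j _; exact: powR_ge0.
have hT : T <= K * (b - a)%:R * v i := hv _ _ _ hi.
have vd : 0 <= v i `^ d by exact: powR_ge0.
have H1 : S <= 2 * (1 + d) * K * (b - a)%:R * v i `^ (1 + d).
  rewrite (powR1D d0 (ltW (v0 _))).
  have h1 : 0 <= (1 + d) * (v i `^ d * (K * (b - a)%:R * v i - T)).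
    by rewrite mulr_ge0 ?mulr_ge0 ?subr_ge0// addr_ge0// ltW.
  have h2 : 0 <= v i `^ d * (3 * K * d * (b - a)%:R * v i).
    by rewrite !mulr_ge0// ltW.
  have h3 : 0 <= (1 - 6 * K * d) * S by rewrite mulr_ge0// subr_ge0.
  have h4 : 0 <= d * S by rewrite mulr_ge0// ltW.
  lra.
apply: le_trans H1 _; rewrite ler_wpM2l//.
  by rewrite !mulr_ge0 ?addr_ge0// ltW.
by apply: ge0_ler_powR; rewrite ?nnegrE ?mi ?addr_ge0// ltW.
Qed.

(** * From weak type to strong type inequalities *)

(* The layer cake formula for [M^s], discretised over the values [a < b < ..] of
   [M]; Young's inequality replaces the integral of [l dl^s] between two
   consecutive values. *)
Lemma layer_cake_le (R : realType) (I : finType) (s : R) (u g M : I -> R) :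
  0 < s -> (forall i, 0 <= u i) -> (forall i, 0 <= M i) ->
  (forall l, 0 < l -> l * \sum_(i | l <= M i) u i
                      <= \sum_(i | l <= M i) u i * g i) ->
  s * \sum_i u i * M i `^ (1 + s) <= (1 + s) * \sum_i u i * (g i * M i `^ s).
Proof.
move=> s0 u0 M0 weak.
(* The share of the levels above [a] in the claim at index [i]; at [a = 0] it is the whole claim. *)
pose Phi a i := u i * ((1 + s) * (g i * (M i `^ s - a `^ s))
                       - s * (M i `^ (1 + s) - a `^ (1 + s))).
(* Induction on the number of indices with [a < M i]: the threshold is raised to the next value [b]
   of [M]. *)
have main a : 0 <= a -> 0 <= \sum_(i | a < M i) Phi a i.
  have [n] := ubnP #|[pred i | a < M i]|.
  elim: n a => // n IH a hn a0.
  have [/existsP[i0 hi0]|/existsPn no] := boolP [exists i, a < M i]; last first.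
    by rewrite big_pred0// => i; apply/negbTE/no.
  case: (@arg_minP _ _ _ i0 (fun i => a < M i) M hi0) => j hj minj.
  set b := M j.
  have b0 : 0 < b := le_lt_trans a0 hj.
  have ab i : (a < M i) = (b <= M i).
    by apply/idP/idP => [/minj//|]; exact: lt_le_trans.
  have hb : 0 <= \sum_(i | b < M i) Phi b i.
    apply: IH; last exact: ltW.
    rewrite ltnS in hn; apply: leq_trans hn; apply: proper_card.
    apply/properP; split.
      by apply/fintype.subsetP => i; rewrite !inE => /(lt_trans hj).
    by exists j; rewrite !inE// /b ltxx.
  (* The difference [Phi a i - Phi b i] no longer involves [M i], so the weak type hypothesis at
     level [b] controls its sum. Indices with [M i = b] have [Phi b i = 0]. *)
  have -> : \sum_(i | a < M i) Phi a i = \sum_(i | b < M i) Phi b i +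
     ((1 + s) * (b `^ s - a `^ s) * \sum_(i | b <= M i) u i * g i
      - s * (b `^ (1 + s) - a `^ (1 + s)) * \sum_(i | b <= M i) u i).
    transitivity (\sum_(i | b <= M i) (Phi b i +
        ((1 + s) * (b `^ s - a `^ s) * (u i * g i)
          - s * (b `^ (1 + s) - a `^ (1 + s)) * u i))).
      by apply: eq_big => // i _; rewrite /Phi; lra.
    rewrite big_split/= sumrB -!mulr_sumr; congr (_ + _).
    rewrite big_mkcond [RHS]big_mkcond/=; apply: eq_bigr => i _.
    case: (ltgtP b (M i)) => //.
    by rewrite /Phi => ->; lra.
  apply: addr_ge0 => //.
  have W := weak _ b0.
  have U0 : 0 <= \sum_(i | b <= M i) u i by apply: sumr_ge0.
  have Y := young_powR s0 (ltW b0) a0.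
  have hba : 0 <= b `^ s - a `^ s.
    by rewrite subr_ge0 ge0_ler_powR ?nnegrE// ltW.
  have hb1 := powR1D s0 (ltW b0).
  set U := \sum_(i | _) u i in W U0 *; set G := \sum_(i | _) _ * _ in W *.
  rewrite hb1 in Y *.
  have h1 : 0 <= (1 + s) * ((b `^ s - a `^ s) * (G - b * U)).
    by rewrite mulr_ge0 ?(mulr_ge0 hba) ?subr_ge0// addr_ge0// ltW.
  have h2 := ler_wpM2l U0 Y.
  lra.
have := main 0 (lexx _).
rewrite (eq_bigr (fun i => (1 + s) * (u i * (g i * M i `^ s)) -
    s * (u i * M i `^ (1 + s)))); last first.
  move=> i _; rewrite /Phi !powR0 ?subr0; [lra | |].
  - by rewrite gt_eqF ?addr_gt0.
  - by rewrite gt_eqF ?addr_gt0.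
rewrite sumrB -!mulr_sumr subr_ge0 => H.
have zero i : ~~ (0 < M i) -> M i = 0.
  by move=> h; apply/eqP; rewrite eq_le M0 leNgt h.
by rewrite big_rmcond ?(big_rmcond (fun i => 0 < M i)) in H => // i /zero ->;
  rewrite powR0 ?mulr0 ?mulr0// gt_eqF ?addr_gt0.
Qed.

(** Young's inequality for [2 * g i] and [M i] bounds twice the right-hand side of the layer cake
    inequality by the target plus its left-hand side; the latter is absorbed, all sums being
    finite. *)
Lemma weak_strong_powR (R : realType) (I : finType) (s : R) (u g M : I -> R) :
  0 < s -> (forall i, 0 <= u i) -> (forall i, 0 <= g i) ->
  (forall i, 0 <= M i) ->
  (forall l, 0 < l -> l * \sum_(i | l <= M i) u i
                      <= \sum_(i | l <= M i) u i * g i) ->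
  s * \sum_i u i * M i `^ (1 + s) <= 2 `^ (1 + s) * \sum_i u i * g i `^ (1 + s).
Proof.
move=> s0 u0 g0 M0 weak; have H := layer_cake_le s0 u0 M0 weak.
suff K : (1 + s) * (2 * \sum_i u i * (g i * M i `^ s)) <=
    2 `^ (1 + s) * \sum_i u i * g i `^ (1 + s)
    + s * \sum_i u i * M i `^ (1 + s).
  by move: H K; set A := \sum_i _; set B := \sum_i _; set C := \sum_i _; lra.
rewrite !mulr_sumr -big_split/=; apply: ler_sum => i _.
have := young_powR s0 (mulr_ge0 (ler0n _ 2) (g0 i)) (M0 i).
rewrite powRM// => /(ler_wpM2l (u0 i)) /le_trans H1.
by rewrite (le_trans _ (H1 _ _))//; lra.
Qed.

(** * The rising sun lemma and weighted maximal averages *)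

Lemma rising_sun (R : realType) (h : nat -> R) (P : pred nat) (n : nat) :
  (forall i, (i < n)%N ->
     P i <-> exists2 j, (i < j <= n)%N & 0 <= \sum_(i <= k < j) h k) ->
  0 <= \sum_(0 <= i < n | P i) h i.
Proof.
(* The strengthened claim: the sum over [P] from [a] on dominates every sum of consecutive terms
   starting at [a]. If [P a] fails, all nonempty such sums are negative, while the induction
   hypothesis makes the sum over [P] nonnegative. *)
move=> hP; suff main m a b : (n - a <= m)%N -> (a <= b <= n)%N ->
    \sum_(a <= k < b) h k <= \sum_(a <= i < n | P i) h i.
  by have := main n 0%N 0%N (leq_subr _ _) (leq0n _); rewrite big_geq.
elim: m a b => [|m IH] a b hm hb.
  by rewrite !big_geq//; lia.
have [an|na] := ltnP a n; last by rewrite !big_geq//; lia.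
rewrite [leRHS]big_ltn_cond//.
have hn : (n - a.+1 <= m)%N by lia.
have IH0 : 0 <= \sum_(a.+1 <= i < n | P i) h i.
  by have := IH a.+1 a.+1 hn; rewrite big_geq//; apply; lia.
have IHS j : (a < j <= n)%N ->
    \sum_(a <= k < j) h k <= h a + \sum_(a.+1 <= i < n | P i) h i.
  by move=> hj; rewrite big_ltn; [rewrite lerD2l; apply: IH => //; lia | lia].
have [Pa|Pa] := boolP (P a).
  have [ab|ba] := ltnP a b; first by apply: IHS; lia.
  rewrite [leLHS]big_geq//; have [j hj] := (hP a an).1 Pa.
  by move=> /le_trans; apply; exact: IHS.
have [ab|ba] := ltnP a b; last by rewrite [leLHS]big_geq.
apply: le_trans IH0; rewrite leNgt; apply/negP => lt0.
move/negP: Pa; apply; apply/(hP a an); exists b; first by lia.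
exact: ltW.
Qed.

Definition wavg (R : realType) (u g : nat -> R) (a b : nat) : R :=
  (\sum_(a <= k < b) u k * g k) / \sum_(a <= k < b) u k.

Lemma sum_nat_gt0 (R : realType) (u : nat -> R) (a b : nat) :
  (forall i, 0 < u i) -> (a < b)%N -> 0 < \sum_(a <= k < b) u k.
Proof.
move=> u0 ab; rewrite big_ltn//; apply: ltr_wpDr => //.
by apply: sumr_ge0 => i _; exact: ltW.
Qed.

Lemma wavg_ge0 (R : realType) (u g : nat -> R) (a b : nat) :
  (forall i, 0 < u i) -> (forall i, 0 <= g i) -> 0 <= wavg u g a b.
Proof.
move=> u0 g0; rewrite divr_ge0//; apply: sumr_ge0 => i _; last exact: ltW.
by rewrite mulr_ge0// ltW.
Qed.

Lemma wavgE (R : realType) (u g : nat -> R) (a b : nat) :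
  (forall i, 0 < u i) -> (a < b)%N ->
  \sum_(a <= k < b) u k * g k = (\sum_(a <= k < b) u k) * wavg u g a b.
Proof.
by move=> u0 ab; rewrite /wavg mulrC divfK// gt_eqF// sum_nat_gt0.
Qed.

(** The level set of the right maximal function [M] at [l] is exactly the rising sun set of
    [u * (g - l)], which gives the weak type inequality with constant 1. *)
Lemma right_wavg_powR (R : realType) (n : nat) (s : R) (u g : nat -> R)
    (b : nat -> nat) :
  0 < s -> (forall i, 0 < u i) -> (forall i, 0 <= g i) ->
  (forall i, (i < n)%N -> (i < b i <= n)%N) ->
  s * \sum_(0 <= i < n) u i * wavg u g i (b i) `^ (1 + s)
    <= 2 `^ (1 + s) * \sum_(0 <= i < n) u i * g i `^ (1 + s).
Proof.
move=> s0 u0 g0 hb.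
(* The index [k] is the last point of the interval. The default 0 of the maximum never reaches a
   level [l > 0]. *)
pose M i := \big[Order.max/0]_(k < n | (i <= k)%N) wavg u g i k.+1.
have M0 i : 0 <= M i by rewrite /M bigmax_ge_id.
have le_avg l i j : (i < j)%N ->
    (l <= wavg u g i j) = (0 <= \sum_(i <= k < j) u k * (g k - l)).
  move=> ij; rewrite ler_pdivlMr ?sum_nat_gt0//.
  rewrite -subr_ge0 mulr_sumr -sumrB; congr (0 <= _).
  by apply: eq_bigr => k _; lra.
have weak l : 0 < l -> l * \sum_(i < n | l <= M i) u i
    <= \sum_(i < n | l <= M i) u i * g i.
  move=> l0; rewrite -subr_ge0 mulr_sumr -sumrB.
  have := @rising_sun _ (fun k => u k * (g k - l)) (fun i => l <= M i) n.
  rewrite big_mkord => H.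
  rewrite (eq_bigr (fun i : 'I_n => u i * (g i - l))); last by move=> i _; lra.
  apply: H => i ni; split.
    move=> /bigmax_geP[|[k ik]]; first by rewrite leNgt l0.
    by rewrite le_avg// => ?; exists k.+1 => //; have := ltn_ord k; lia.
  case=> j hj; rewrite -le_avg; last by lia.
  move=> hl; apply/bigmax_geP; right.
  have jn : (j.-1 < n)%N by lia.
  exists (Ordinal jn) => /=; first by lia.
  by rewrite prednK//; lia.
have := @weak_strong_powR R 'I_n s u g M s0 (fun i => ltW (u0 i)) g0 M0 weak.
rewrite !big_mkord; apply: le_trans; rewrite ler_pM2l//; apply: ler_sum => i _.
rewrite ler_pM2l//; apply: ge0_ler_powR; rewrite ?nnegrE ?wavg_ge0 ?addr_ge0//.
  exact: ltW.
have hi := hb i (ltn_ord i).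
have bn : ((b i).-1 < n)%N by lia.
have -> : b i = (Ordinal bn).+1 by rewrite /=; lia.
by apply: le_bigmax_cond => /=; lia.
Qed.

Lemma sum_nat_rev (R : realType) (F : nat -> R) (n a b : nat) :
  (a <= b <= n)%N ->
  \sum_(a <= k < b) F k = \sum_(n - b <= k < n - a) F (n - k.+1)%N.
Proof.
elim: b => [|b IH] hb; first by rewrite !big_geq//; lia.
have [ab|ab] := eqVneq a b.+1; first by rewrite ab !big_geq.
rewrite big_nat_recr/=; last by lia.
rewrite IH; last by lia.
rewrite [RHS]big_ltn; last by lia.
rewrite addrC; congr (F _ + _); first by lia.
by rewrite subnSK//; lia.
Qed.

(** The reflection [i -> n - i.+1] exchanges intervals ending at their base point with intervals
    starting there. *)
Lemma left_wavg_powR (R : realType) (n : nat) (s : R) (u g : nat -> R)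
    (a : nat -> nat) :
  0 < s -> (forall i, 0 < u i) -> (forall i, 0 <= g i) ->
  (forall i, (i < n)%N -> (a i <= i)%N) ->
  s * \sum_(0 <= i < n) u i * wavg u g (a i) i.+1 `^ (1 + s)
    <= 2 `^ (1 + s) * \sum_(0 <= i < n) u i * g i `^ (1 + s).
Proof.
move=> s0 u0 g0 ha; pose r i := (n - i.+1)%N.
have rev F : \sum_(0 <= i < n) F i = \sum_(0 <= i < n) F (r i) :> R.
  by rewrite (@sum_nat_rev _ F n 0 n) ?leqnn// subnn subn0.
rewrite rev [in leRHS]rev.
have hr i : (i < n)%N -> (i < n - a (r i) <= n)%N.
  by move=> ni; have := ha (r i); rewrite /r; lia.
apply: le_trans (right_wavg_powR s0 (fun i => u0 (r i)) (fun i => g0 (r i)) hr).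
rewrite ler_pM2l// le_eqVlt; apply/orP; left; apply/eqP.
apply: eq_big_nat => i /andP[_ ni].
have hi : (a (r i) <= (r i).+1 <= n)%N by have := ha (r i); rewrite /r; lia.
congr (_ * _ `^ _); rewrite /wavg !(sum_nat_rev _ hi).
by have -> : (n - (r i).+1)%N = i by rewrite /r; lia.
Qed.

(** The two sides share the base point and cover the interval; each has at most the total mass of
    [u], so its own average only has a smaller denominator. *)
Lemma wavg_le_sides (R : realType) (u g : nat -> R) (a i b : nat) :
  (forall i, 0 < u i) -> (forall i, 0 <= g i) -> (a <= i < b)%N ->
  wavg u g a b <= wavg u g a i.+1 + wavg u g i b.
Proof.
move=> u0 g0 hi.
have U0 : 0 < \sum_(a <= k < b) u k by apply: sum_nat_gt0 => //; lia.
have cut F (F0 : forall k, 0 <= F k) : \sum_(a <= k < b) F k <=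
    \sum_(a <= k < i.+1) F k + \sum_(i <= k < b) F k :> R.
  rewrite (big_cat_nat (n := i.+1))/=; try lia.
  by rewrite lerD2l [leRHS]big_ltn ?lerDr//; lia.
have sub1 : \sum_(a <= k < i.+1) u k <= \sum_(a <= k < b) u k.
  rewrite [leRHS](big_cat_nat (n := i.+1))/=; try lia.
  by rewrite lerDl sumr_ge0// => k _; exact: ltW.
have sub2 : \sum_(i <= k < b) u k <= \sum_(a <= k < b) u k.
  rewrite [leRHS](big_cat_nat (n := i))/=; try lia.
  by rewrite lerDr sumr_ge0// => k _; exact: ltW.
rewrite {1}/wavg ler_pdivrMr//.
apply: le_trans (cut _ (fun k => mulr_ge0 (ltW (u0 k)) (g0 k))) _.
rewrite !wavgE//; try lia.
rewrite mulrDl lerD//; rewrite mulrC ler_wpM2l// wavg_ge0//.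
Qed.

Lemma wavg_powR (R : realType) (n : nat) (s : R) (u g : nat -> R)
    (a b : nat -> nat) :
  0 < s -> (forall i, 0 < u i) -> (forall i, 0 <= g i) ->
  (forall i, (i < n)%N -> (a i <= i < b i)%N /\ (b i <= n)%N) ->
  s * \sum_(0 <= i < n) u i * wavg u g (a i) (b i) `^ (1 + s)
    <= 2 * 4 `^ (1 + s) * \sum_(0 <= i < n) u i * g i `^ (1 + s).
Proof.
move=> s0 u0 g0 hab; have s1 : 0 <= 1 + s by rewrite addr_ge0// ltW.
have L := @left_wavg_powR _ n s u g a s0 u0 g0.
have {}L := L (fun i hi => proj1 (andP (hab i hi).1)).
have Rr : forall i, (i < n)%N -> (i < b i <= n)%N.
  by move=> i /hab; lia.
have {}Rr := right_wavg_powR s0 u0 g0 Rr.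
(* One factor [2^(1 + s)] comes from the one-sided bounds, the other from bounding the power of a
   sum of two averages; the remaining 2 counts the sides. *)
have -> : (4 : R) = 2 * 2 by lra.
rewrite powRM//; set c := 2 `^ (1 + s) in L Rr *.
have c0 : 0 <= c by exact: powR_ge0.
apply: le_trans (_ : s * (\sum_(0 <= i < n) c *
    (u i * wavg u g (a i) i.+1 `^ (1 + s) +
     u i * wavg u g i (b i) `^ (1 + s))) <= _); last first.
  rewrite -mulr_sumr big_split/= mulrCA.
  have := ler_wpM2l c0 (lerD L Rr).
  by set X := \sum_(_ <= _ < _) _; set Y := \sum_(_ <= _ < _) _;
    set Z := \sum_(_ <= _ < _) _; lra.
rewrite ler_pM2l// big_nat_cond [leRHS]big_nat_cond.
apply: ler_sum => i /andP[/andP[_ ni] _]; rewrite -mulrDr mulrCA ler_pM2l//.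
have hi := hab i ni; have := wavg_le_sides u0 g0 hi.1.
set A := wavg u g _ _; set B := wavg u g _ _; set D := wavg u g _ _ => ABD.
have [A0 B0 D0] : [/\ 0 <= A, 0 <= B & 0 <= D] by split; apply: wavg_ge0.
have mono x y : 0 <= x -> x <= y -> x `^ (1 + s) <= y `^ (1 + s).
  by move=> x0 xy; apply: ge0_ler_powR; rewrite ?nnegrE// (le_trans x0).
have [BD|/ltW DB] := leP B D.
  apply: le_trans (mono _ (2 * D) A0 _) _; first by lra.
  by rewrite powRM// ler_wpM2l// lerDr powR_ge0.
apply: le_trans (mono _ (2 * B) A0 _) _; first by lra.
by rewrite powRM// ler_wpM2l// lerDl powR_ge0.
Qed.

(** Young's inequality between each [g k] and the mean [A], summed against [u]: the left-hand sides
    add up to [1 + s] times the mass times [A^(1 + s)]. *)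
Lemma wavg_jensen (R : realType) (s : R) (u g : nat -> R) (a b : nat) :
  0 < s -> (forall i, 0 < u i) -> (forall i, 0 <= g i) -> (a < b)%N ->
  (\sum_(a <= k < b) u k) * wavg u g a b `^ (1 + s)
    <= \sum_(a <= k < b) u k * g k `^ (1 + s).
Proof.
move=> s0 u0 g0 ab; set A := wavg u g a b.
have A0 : 0 <= A by apply: wavg_ge0.
have H : \sum_(a <= k < b) u k * ((1 + s) * (g k * A `^ s)) <=
    \sum_(a <= k < b) u k * (g k `^ (1 + s) + s * A `^ (1 + s)).
  by apply: ler_sum => k _; rewrite ler_pM2l// young_powR.
have E1 : \sum_(a <= k < b) u k * ((1 + s) * (g k * A `^ s)) =
    (1 + s) * ((\sum_(a <= k < b) u k) * A `^ (1 + s)).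
  rewrite powR1D// (mulrA (\sum_(_ <= _ < _) _)) -wavgE// mulr_suml mulr_sumr.
  by apply: eq_bigr => k _; lra.
have E2 : \sum_(a <= k < b) u k * (g k `^ (1 + s) + s * A `^ (1 + s)) =
    \sum_(a <= k < b) u k * g k `^ (1 + s)
    + s * ((\sum_(a <= k < b) u k) * A `^ (1 + s)).
  rewrite mulr_suml mulr_sumr -big_split/=.
  by apply: eq_bigr => k _; lra.
rewrite E1 E2 in H; lra.
Qed.

(** * Fractional averages for A_1 weights *)

(* Hedberg's trick: [U^alpha A = (U A^p)^(alpha) A^(p / q)], and [U A^p] is at
   most the total mass of [g^p] by Jensen's inequality. *)
Lemma frac_wavg_powR (R : realType) (n : nat) (alpha p q : R) (u g : nat -> R)
    (a b : nat -> nat) :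
  0 < alpha -> 1 < p -> 0 < q -> q^-1 = p^-1 - alpha ->
  (forall i, 0 < u i) -> (forall i, 0 <= g i) ->
  (forall i, (i < n)%N -> (a i <= i < b i)%N /\ (b i <= n)%N) ->
  \sum_(0 <= i < n) u i * ((\sum_(a i <= k < b i) u k) `^ alpha
                            * wavg u g (a i) (b i)) `^ q
    <= 2 * 4 `^ p / (p - 1) * (\sum_(0 <= i < n) u i * g i `^ p) `^ (q / p).
Proof.
move=> al0 p1 q0 hq u0 g0 hab.
have p0 : 0 < p by lra.
pose s := p - 1; have s0 : 0 < s by rewrite /s; lra.
have ps : p = 1 + s by rewrite /s; lra.
(* This splits the final power of [e] into [e^(alpha * q)], from Jensen's inequality, and [e], from
   the maximal inequality. *)
have hb : q / p = alpha * q + 1.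
  have -> : p^-1 = q^-1 + alpha by lra.
  by rewrite mulrDr divff ?gt_eqF// mulrC addrC.
set e := \sum_(0 <= i < n) u i * g i `^ p.
have e0 : 0 <= e by apply: sumr_ge0 => i _; rewrite mulr_ge0 ?powR_ge0// ltW.
have aq : 0 <= alpha * q by rewrite mulr_ge0// ltW.
apply: (@le_trans _ _ (\sum_(0 <= i < n)
    e `^ (alpha * q) * (u i * wavg u g (a i) (b i) `^ p))).
  rewrite big_nat_cond [leRHS]big_nat_cond.
  apply: ler_sum => i /andP[/andP[_ ni] _]; rewrite [leRHS]mulrCA ler_pM2l//.
  have [hi bn] := hab i ni; set U := \sum_(_ <= _ < _) _.
  set A := wavg _ _ _ _; have A0 : 0 <= A by apply: wavg_ge0.
  have U0 : 0 < U by apply: sum_nat_gt0 => //; lia.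
  have Ue : U * A `^ p <= e.
    rewrite ps; apply: le_trans (wavg_jensen s0 u0 g0 _) _; first by lia.
    rewrite /e -ps (@big_cat_nat _ _ _ (a i) 0 n)/=; try lia.
    rewrite (@big_cat_nat _ _ _ (b i) (a i) n)/=; try lia.
    rewrite addrCA lerDl addr_ge0// sumr_ge0// => k _;
      by rewrite mulr_ge0 ?powR_ge0// ltW.
  have -> : (U `^ alpha * A) `^ q = (U * A `^ p) `^ (alpha * q) * A `^ p.
    rewrite (powRM _ (powR_ge0 _ _) A0) (powRM _ (ltW U0) (powR_ge0 _ _)).
    rewrite -!powRrM -mulrA; congr (_ * _).
    rewrite -powRD; last first.
      by rewrite gt_eqF// ltr_wpDl// mulr_ge0// ltW.
    congr (_ `^ _); have : p * (q / p) = q by rewrite mulrC divfK// gt_eqF.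
    rewrite hb; lra.
  rewrite ler_wpM2r ?powR_ge0//; apply: ge0_ler_powR; rewrite ?nnegrE//.
  by rewrite mulr_ge0 ?powR_ge0// ltW.
rewrite -mulr_sumr.
have := wavg_powR s0 u0 g0 hab; rewrite -ps -/e -/s => H.
have {}H : \sum_(0 <= i < n) u i * wavg u g (a i) (b i) `^ p
    <= 2 * 4 `^ p / s * e by rewrite mulrAC ler_pdivlMr// mulrC.
rewrite hb powRD; last by rewrite gt_eqF// ltr_wpDl.
rewrite powRr1// mulrCA; apply: ler_wpM2l H; exact: powR_ge0.
Qed.

Lemma frac_max_nat (R : realType) (n : nat) (alpha K p q : R)
    (u f : nat -> R) (a b : nat -> nat) :
  0 < alpha -> alpha < 1 -> 0 < K -> 1 < p -> 0 < q -> q^-1 = p^-1 - alpha ->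
  (forall i, 0 < u i) -> nat_A1 K u -> (forall i, 0 <= f i) ->
  (forall i, (i < n)%N -> (a i <= i < b i)%N /\ (b i <= n)%N) ->
  \sum_(0 <= i < n) u i * (((b i - a i)%:R `^ (1 - alpha))^-1
                            * \sum_(a i <= k < b i) f k) `^ q
    <= (K `^ (1 - alpha)) `^ q * (2 * 4 `^ p / (p - 1))
       * (\sum_(0 <= i < n) f i `^ p * u i `^ (p / q)) `^ (q / p).
Proof.
move=> al0 al1 K0 p1 q0 hq u0 hu f0 hab.
have p0 : 0 < p by lra.
pose g i := f i * u i `^ (- alpha).
have g0 i : 0 <= g i by rewrite mulr_ge0 ?powR_ge0.
(* With this exponent, [f^p u^(p / q)] equals [u g^p]. *)
have hp : p / q = 1 - alpha * p.
  by rewrite hq mulrBr divff ?gt_eqF// mulrC.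
have -> : \sum_(0 <= i < n) f i `^ p * u i `^ (p / q) =
    \sum_(0 <= i < n) u i * g i `^ p.
  apply: eq_bigr => i _; rewrite /g powRM ?powR_ge0// -powRrM mulrCA.
  congr (_ * _); rewrite hp mulNr powRD ?powRr1 ?(ltW (u0 _))//.
  by apply/implyP => _; rewrite gt_eqF.
have F := frac_wavg_powR al0 p1 q0 hq u0 g0 hab.
rewrite -mulrA; apply: le_trans (ler_wpM2l (powR_ge0 _ _) F).
rewrite mulr_sumr big_nat_cond [leRHS]big_nat_cond.
apply: ler_sum => i /andP[/andP[_ ni] _]; rewrite [leRHS]mulrCA ler_pM2l//.
have [hi bn] := hab i ni.
have ab : (a i < b i)%N by lia.
have U0 := sum_nat_gt0 u0 ab; set U := \sum_(_ <= _ < _) u _ in U0 *.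
set A := wavg _ _ _ _; have A0 : 0 <= A by apply: wavg_ge0.
have L0 : 0 < (b i - a i)%:R :> R by rewrite ltr0n subn_gt0.
rewrite -(powRM q (powR_ge0 _ _) (mulr_ge0 (powR_ge0 _ _) A0)).
apply: ge0_ler_powR; rewrite ?nnegrE.
- exact: ltW.
- by rewrite mulr_ge0 ?invr_ge0 ?powR_ge0// sumr_ge0.
- exact: mulr_ge0 (powR_ge0 _ _) (mulr_ge0 (powR_ge0 _ _) A0).
have UA : U `^ alpha * A =
    (U `^ (1 - alpha))^-1 * \sum_(a i <= k < b i) u k * g k.
  rewrite (wavgE g u0 ab) -/U -/A [RHS]mulrA; congr (_ * A).
  rewrite -powRN opprB -[X in _ = _ * X](powRr1 (ltW U0)) -powRD ?subrK//.
  by apply/implyP => _; rewrite gt_eqF.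
(* The A_1 bound of [U] by [K (b i - a i) u k], raised to the power [1 - alpha], is used at each
   [k], together with [u g = f u^(1 - alpha)]. *)
have key : (\sum_(a i <= k < b i) f k) * U `^ (1 - alpha) <=
    K `^ (1 - alpha) * (b i - a i)%:R `^ (1 - alpha)
      * \sum_(a i <= k < b i) u k * g k.
  rewrite mulr_suml mulr_sumr big_nat_cond [leRHS]big_nat_cond.
  apply: ler_sum => k /andP[hk _].
  have -> : u k * g k = f k * u k `^ (1 - alpha).
    rewrite /g powRD ?powRr1 ?(ltW (u0 _)) 1?mulrCA//.
    by apply/implyP => _; rewrite gt_eqF.
  rewrite mulrCA ler_wpM2l// -!powRM ?mulr_ge0 ?(ltW (u0 _)) ?(ltW K0)//.
  apply: ge0_ler_powR; rewrite ?nnegrE ?mulr_ge0 ?(ltW (u0 _)) ?(ltW K0)//.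
  - by rewrite subr_ge0 ltW.
  - exact: ltW.
  - exact: hu.
rewrite UA mulrC ler_pdivrMr ?powR_gt0//.
have -> : forall x y z t : R, x * (y * z) * t = x * t * z * y by move=> *; lra.
by rewrite ler_pdivlMr ?powR_gt0.
Qed.

(** * Transfer between windows of integers and segments of naturals *)

Lemma sum_symint (R : realType) (F : int -> R) (m c : int) (N a : nat) :
  a%:Z + c = m - N%:Z ->
  \sum_(k \in symint m N) F k = \sum_(a <= i < a + (2 * N + 1)) F (i%:Z + c).
Proof.
move=> hac.
rewrite (@reindex_fsbig _ _ _ _ _
  (fun i : nat => (a + i)%:Z + c) `I_(2 * N + 1)).
  rewrite -fsbig_ord -[X in _ = \big[_/_]_(X <= _ < _) _]add0n.
  rewrite big_addn addKn big_mkord.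
  by apply: eq_bigr => i _; rewrite addnC.
split.
- by move=> i; rewrite /symint /= => hi; lia.
- by move=> i j _ _ /=; lia.
- move=> k; rewrite /symint /= => hk.
  by exists (absz (k - c - a%:Z)%R) => /=; lia.
Qed.

Lemma symint0E (L : nat) (m : int) : symint 0 L m <-> (`|m| <= L)%N.
Proof. by rewrite /symint /= subr0; split; lia. Qed.

Lemma A1_weight_nat (R : realType) (q : R) (w : int -> R) :
  0 < q -> discrete_weight w -> A1_weight q w ->
  exists2 K, 0 < K & forall c, nat_A1 K (fun i : nat => w (i%:Z + c) `^ q).
Proof.
move=> q0 w0 hA.
pose avg m N := (2 * N + 1)%:R^-1 * \sum_(k \in symint m N) w k `^ q.
have avg0 m N : 0 <= avg m N.
  by rewrite mulr_ge0 ?invr_ge0 ?ler0n// fsumr_ge0// => k _; exact: powR_ge0.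
have le_char m N k : symint m N k ->
    ((avg m N `^ q^-1 / w k)%:E <= A1_char q w)%E.
  move=> hk; rewrite EFinM; apply: le_trans (_ : _ <= (avg m N `^ q^-1)%:E *
      ereal_sup [set ((w k)^-1)%:E | k in symint m N])%E _.
    rewrite lee_wpmul2l ?lee_fin ?powR_ge0//.
    by apply: ereal_sup_ubound; exists k.
  by apply: ereal_sup_ubound; exists m => //; exists N.
have self k : symint k 0 k by rewrite /symint /= subrr normr0.
have [K hK] : exists K, A1_char q w = K%:E.
  have := le_char 0 0%N 0 (self 0); move: hA; rewrite /A1_weight.
  by case: (A1_char q w) => // K _ _; exists K.
have K0 : 0 <= K.
  have := le_char 0 0%N 0 (self 0); rewrite hK lee_fin; apply: le_trans.
  by rewrite divr_ge0 ?powR_ge0// ltW.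
have le_sum m N k : symint m N k ->
    \sum_(j \in symint m N) w j `^ q <= K `^ q * (2 * N + 1)%:R * w k `^ q.
  move=> hk; have := le_char m N k hk; rewrite hK lee_fin ler_pdivrMr// => h.
  have N0 : 0 < (2 * N + 1)%:R :> R by rewrite ltr0n; lia.
  have : avg m N <= (K * w k) `^ q.
    rewrite -[leLHS]powRr1// -(mulVf (lt0r_neq0 q0)) powRrM.
    apply: ge0_ler_powR h; rewrite ?nnegrE ?powR_ge0//; first exact: ltW.
    by rewrite mulr_ge0// ltW.
  rewrite powRM ?(ltW (w0 _))// /avg mulrC ler_pdivrMr//.
  by move=> /le_trans; apply; rewrite mulrAC.
(* An arbitrary interval is extended to the right to odd length, at most doubling it; the added 1
   makes the constant positive. *)
exists (2 * K `^ q + 1); first by rewrite ltr_wpDl// mulr_ge0// powR_ge0.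
move=> c a b i hi; pose N := (b - a)./2.
have Nb : (b <= a + (2 * N + 1))%N by rewrite /N; lia.
have v0 k : 0 <= w k `^ q by exact: powR_ge0.
apply: le_trans (_ : _ <= \sum_(a <= j < a + (2 * N + 1)) w (j%:Z + c) `^ q) _.
  rewrite [leRHS](@big_cat_nat _ _ _ b)/= ?lerDl ?sumr_ge0//; lia.
rewrite -(@sum_symint _ (fun k => w k `^ q) (a%:Z + c + N%:Z)); last by lia.
apply: le_trans (le_sum _ _ (i%:Z + c) _) _.
  by rewrite /symint /= /N; lia.
rewrite ler_wpM2r//; apply: (@le_trans _ _ (K `^ q * (2 * (b - a)%:R))).
  by rewrite ler_wpM2l ?powR_ge0// -natrM ler_nat /N; lia.
by rewrite mulrA (mulrC _ 2) ler_wpM2r// lerDl.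
Qed.

(** The quantity under the supremum in [frac_max], with the radius exposed so that it can be chosen
    point by point. *)
Definition frac_avg (R : realType) (alpha : R) (x : int -> R) (N : nat)
    (m : int) : R :=
  ((2 * N + 1)%:R `^ (1 - alpha))^-1 * \sum_(k \in symint m N) `|x k|.

Lemma frac_avg_ge0 (R : realType) (alpha : R) (x : int -> R) (N : nat)
    (m : int) :
  0 <= frac_avg alpha x N m.
Proof. by rewrite mulr_ge0 ?invr_ge0 ?powR_ge0// fsumr_ge0. Qed.

(** The constant is fixed before the sequence, the radii and the window, which permits the later
    passage to suprema and infinite sums. *)
Lemma frac_avg_window (R : realType) (alpha K p q : R) (w : int -> R) :
  0 < alpha -> alpha < 1 -> 0 < K -> 1 < p -> 0 < q -> q^-1 = p^-1 - alpha ->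
  discrete_weight w ->
  (forall c, nat_A1 K (fun i : nat => w (i%:Z + c) `^ q)) ->
  exists2 C, 0 < C & forall (x : int -> R) (N : int -> nat) (L : nat),
    (forall m, symint 0 L m -> (`|m| + N m <= L)%N) ->
    \sum_(m \in symint 0 L) (frac_avg alpha x (N m) m * w m) `^ q
      <= C * (\sum_(k \in symint 0 L) (`|x k| * w k) `^ p) `^ (q / p).
Proof.
move=> al0 al1 K0 p1 q0 hq w0 hA.
exists ((K `^ (1 - alpha)) `^ q * (2 * 4 `^ p / (p - 1))).
  by rewrite !mulr_gt0 ?powR_gt0 ?invr_gt0 ?subr_gt0.
move=> x N L hN.
rewrite !(@sum_symint _ _ 0 (- L%:Z) L 0); try lia.
rewrite add0n.
(* The truncated subtraction is exact, since the intervals stay inside the window. *)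
pose a i := (i - N (i%:Z - L%:Z)%R)%N.
pose b i := (a i + (2 * N (i%:Z - L%:Z)%R + 1))%N.
have hab i : (i < 2 * L + 1)%N ->
    (N (i%:Z - L%:Z)%R <= i)%N /\ (i + N (i%:Z - L%:Z)%R < 2 * L + 1)%N.
  by move=> hi; have := hN (i%:Z - L%:Z)%R; rewrite /symint /=; lia.
have hab' i : (i < 2 * L + 1)%N -> (a i <= i < b i)%N /\ (b i <= 2 * L + 1)%N.
  by move=> /hab; rewrite /b /a; lia.
have := @frac_max_nat R _ alpha K p q (fun i => w (i%:Z - L%:Z) `^ q)
  (fun i => `|x (i%:Z - L%:Z)|) a b al0 al1 K0 p1 q0 hq
  (fun i => powR_gt0 q (w0 _)) (hA (- L%:Z)) (fun i => normr_ge0 _) hab'.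
congr (_ <= _ * _ `^ _).
  apply: eq_big_nat => i /andP[_ /hab hi].
  rewrite powRM ?frac_avg_ge0 ?(ltW (w0 _))// mulrC /frac_avg.
  rewrite (@sum_symint _ (fun k => `|x k|) _ (- L%:Z) _ (a i)).
    by rewrite /b addKn.
  by rewrite /a; lia.
apply: eq_bigr => i _; rewrite powRM ?(ltW (w0 _))//; congr (_ * _).
by rewrite -powRrM mulrC divfK// gt_eqF.
Qed.

(** * Passage to suprema and infinite sums *)

(** Otherwise every average would be below half of the supremum, which would then be positive and at
    most half of itself. *)
Lemma frac_max_le_frac_avg (R : realType) (alpha : R) (x : int -> R) (m : int) :
  (frac_max alpha x m < +oo)%E ->
  exists N, (frac_max alpha x m <= (2 * frac_avg alpha x N m)%:E)%E.
Proof.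
move=> fin; have le N : ((frac_avg alpha x N m)%:E <= frac_max alpha x m)%E.
  by apply: ereal_sup_ubound; exists N.
have [M hM] : exists M, frac_max alpha x m = M%:E.
  by have := le 0%N; move: fin; case: (frac_max _ _ _) => // M _ _; exists M.
apply: contrapT => no.
have big N : 2 * frac_avg alpha x N m < M.
  rewrite ltNge; apply/negP => h; apply: no; exists N.
  by rewrite hM lee_fin.
have M0 : 0 < M.
  by apply: le_lt_trans (big 0%N); rewrite mulr_ge0 ?frac_avg_ge0.
suff : (M%:E <= (M / 2)%:E)%E by rewrite lee_fin; lra.
rewrite -hM; apply: ge_ereal_sup => _ [N _ <-]; rewrite lee_fin.
have := big N; rewrite /frac_avg; lra.
Qed.

Lemma frac_max_strong (R : realType) (alpha K p q : R) (w : int -> R) :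
  0 < alpha -> alpha < 1 -> 0 < K -> 1 < p -> 0 < q -> q^-1 = p^-1 - alpha ->
  discrete_weight w ->
  (forall c, nat_A1 K (fun i : nat => w (i%:Z + c) `^ q)) ->
  exists2 C, 0 < C & forall x : int -> R, wlspace p w x ->
    (wlnorm q w (frac_max alpha x) <= C%:E * wlnorm p w (EFin \o x))%E.
Proof.
move=> al0 al1 K0 p1 q0 hq w0 hA.
have p0 : 0 < p by lra.
have [C C0 HC] := frac_avg_window al0 al1 K0 p1 q0 hq w0 hA.
exists ((2 `^ q * C) `^ q^-1).
  by rewrite powR_gt0// mulr_gt0// powR_gt0.
move=> x; rewrite /wlspace /= /wlnorm.
set E := (\esum_(k in _) _)%E => hE.
pose y k := (`|x k| * w k) `^ p.
have y0 k : 0 <= y k by exact: powR_ge0.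
have yE k : poweR `|(EFin \o x) k * (w k)%:E|%E p = (y k)%:E.
  rewrite (_ : ((EFin \o x) k * (w k)%:E)%E = (x k * w k)%:E)//.
  by rewrite abse_EFin poweR_EFin normrM (gtr0_norm (w0 k)).
have E0 : (0 <= E)%E by apply: esum_ge0 => k _; exact: poweR_ge0.
have {hE} [e hE] : exists e, E = e%:E.
  have : (E < +oo)%E by apply: lty_poweRy hE; rewrite invr_eq0 gt_eqF.
  by case: (E) E0 => // e _ _; exists e.
have e0 : 0 <= e by rewrite -lee_fin -hE.
have he L : \sum_(k \in symint 0 L) y k <= e.
  rewrite -lee_fin -hE -fsumEFin; last exact: finite_symint.
  apply: esum_ge; exists (symint 0 L); first by split=> //;
    exact: finite_symint.
  by apply: lee_fsum; [exact: finite_symint | move=> k _; rewrite yE].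
have pq0 : 0 <= q / p by rewrite divr_ge0// ltW.
set B := C * e `^ (q / p); have B0 : 0 <= B by rewrite mulr_ge0 ?powR_ge0// ltW.
pose z N m := (frac_avg alpha x N m * w m) `^ q.
have z0 N m : 0 <= z N m by exact: powR_ge0.
have fin_bound (A : set int) (N : int -> nat) : finite_set A ->
    (\sum_(m \in A) (z (N m) m)%:E <= B%:E)%E.
  (* Radius 0 off [A] keeps every interval inside a window large enough for the finitely many points
     of [A]. *)
  move=> finA; pose N' m := if m \in A then N m else 0%N.
  pose L := (\max_(m <- finmap.enum_fset (fset_set A)) (`|m| + N' m))%N.
  have AL m : A m -> (`|m| + N' m <= L)%N.
    move=> Am; apply: (@leq_bigmax_seq _ _ _ (fun m => `|m| + N' m)%N) => //.
    by rewrite in_fset_set// inE.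
  have hN m : symint 0 L m -> (`|m| + N' m <= L)%N.
    have [/set_mem/AL//|mA] := boolP (m \in A).
    by rewrite /N' (negbTE mA) addn0 => /symint0E.
  apply: le_trans (_ : _ <= \sum_(m \in symint 0 L) (z (N' m) m)%:E)%E _.
    apply: le_trans (_ : _ <= \sum_(m \in A) (z (N' m) m)%:E)%E _.
      by apply: (lee_fsum finA) => m Am; rewrite /N' mem_set.
    apply: lee_fsum_nneg_subset => //; first exact: finite_symint.
      move=> m /set_mem/AL/(leq_trans (leq_addr _ _)) mL.
      exact/mem_set/symint0E.
    by move=> m _; rewrite lee_fin.
  rewrite fsumEFin; last exact: finite_symint.
  rewrite lee_fin; apply: le_trans (HC x N' L hN) _.
  apply: ler_wpM2l; first exact: ltW.
  by apply: ge0_ler_powR (he L); rewrite ?nnegrE ?fsumr_ge0// => k _; exact: y0.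
(* The bound on a singleton is uniform in the radius, so the supremum at each point is finite. *)
have fin_max m : (frac_max alpha x m < +oo)%E.
  apply: le_lt_trans (_ : ((B `^ q^-1 / w m)%:E < +oo)%E); last exact: ltry.
  apply: ge_ereal_sup => _ [N _ <-]; rewrite lee_fin -/(frac_avg alpha x N m).
  rewrite ler_pdivlMr//.
  have := fin_bound [set m] (fun=> N) (finite_set1 m).
  rewrite fsbig_set1 lee_fin => zB.
  have t0 : 0 <= frac_avg alpha x N m * w m.
    by rewrite mulr_ge0 ?frac_avg_ge0// ltW.
  rewrite -[leLHS]powRr1// -(divff (lt0r_neq0 q0)) powRrM.
  by apply: ge0_ler_powR; rewrite ?nnegrE ?powR_ge0 ?invr_ge0 ?(ltW q0)//.
(* One radius per point nearly attains the supremum; the loss of a factor 2 accounts for [2^q] in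
   the constant. *)
have [N hN] := choice (fun m => frac_max_le_frac_avg (fin_max m)).
have main : (\esum_(m in [set: int]) poweR `|frac_max alpha x m * (w m)%:E| q
    <= (2 `^ q * B)%:E)%E.
  apply: ge_ereal_sup => _ [A [finA _] <-].
  apply: le_trans (_ : _ <= \sum_(m \in A) (2 `^ q)%:E * (z (N m) m)%:E)%E _.
    apply: lee_fsum => // m _.
    have M0 : (0 <= frac_max alpha x m)%E.
      apply: (@le_trans _ _ (frac_avg alpha x 0 m)%:E).
        by rewrite lee_fin frac_avg_ge0.
      by apply: ereal_sup_ubound; exists 0%N.
    have W0 : (0 <= (w m)%:E)%E by rewrite lee_fin ltW.
    have T0 := mulr_ge0 (frac_avg_ge0 alpha x (N m) m) (ltW (w0 m)).
    rewrite gee0_abs ?mule_ge0// /z -EFinM -(powRM q (ler0n R 2) T0).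
    rewrite -poweR_EFin; apply: gt0_ler_poweR; first exact: ltW.
    - by rewrite in_itv /= mule_ge0// leey.
    - by rewrite in_itv /= leey andbT lee_fin; exact: mulr_ge0 (ler0n R 2) T0.
    - by rewrite mulrA EFinM lee_wpmul2r.
  rewrite -(@ge0_mule_fsumr _ _ _ (fun m => (z (N m) m)%:E)); last first.
    by move=> m; rewrite lee_fin.
  by rewrite EFinM lee_wpmul2l ?lee_fin ?powR_ge0// fin_bound.
apply: le_trans (gt0_ler_poweR _ _ _ main) _.
- by rewrite invr_ge0 ltW.
- by rewrite in_itv /= leey esum_ge0// => m _; exact: poweR_ge0.
- by rewrite in_itv /= leey lee_fin mulr_ge0 ?powR_ge0.
rewrite hE !poweR_EFin -EFinM lee_fin /B mulrA.
rewrite (powRM _ _ (powR_ge0 _ _)); last by rewrite mulr_ge0 ?powR_ge0// ltW.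
rewrite -(powRrM e) (_ : q / p * q^-1 = p^-1)//.
by rewrite mulrAC divff ?mul1r// gt_eqF.
Qed.

(** * Choice of the exponents *)

Unset Implicit Arguments.

Theorem theorem4p1 (R : realType) (alpha q0 : R) (w : int -> R)
    (halpha0 : 0 < alpha) (halpha1 : alpha < 1)
    (hq0 : 1 < q0) (hq0E : q0^-1 = 1 - alpha)
    (hw : discrete_weight w) (hA : A1_weight q0 w) :
  exists q1 p1 : R,
    [/\ q0 < q1, 1 < p1, p1 < alpha^-1 & q1^-1 = p1^-1 - alpha] /\
    forall t p q : R, 0 <= t -> t < 1 ->
      p^-1 = t + (1 - t) / p1 -> q^-1 = t / q0 + (1 - t) / q1 ->
      exists C : R, 0 < C /\
        forall x : int -> R, x \in wlspace p w ->
          (wlnorm q w (frac_max alpha x)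
             <= C%:E * wlnorm p w (EFin \o x))%E.
Proof.
have q00 : 0 < q0 by lra.
have [K K0 hK] := A1_weight_nat q00 hw hA.
(* The largest gain that the self-improvement of [w^q0] allows. *)
pose d := (6 * K)^-1; have d0 : 0 < d by rewrite invr_gt0 mulr_gt0.
pose q1 := q0 * (1 + d).
have q01 : q0 < q1 by rewrite /q1 ltr_pMr// ltrDl.
have q10 : 0 < q1 by lra.
have iq10 : 0 < q1^-1 by rewrite invr_gt0.
have iq01 : q1^-1 < q0^-1 by rewrite ltf_pV2.
pose p1 := (q1^-1 + alpha)^-1.
have ip1 : p1^-1 = q1^-1 + alpha by rewrite invrK.
exists q1, p1; split.
  split=> //; last by lra.
    by rewrite invf_gt1; lra.
  by rewrite ltf_pV2 ?posrE; lra.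
move=> t p q t0 t1 hp hq.
have t10 : 0 < 1 - t by lra.
have iq0 : 0 < q^-1.
  rewrite hq; have := mulr_gt0 t10 iq10.
  have : 0 <= t / q0 by rewrite divr_ge0// ltW.
  by lra.
have q_gt0 : 0 < q by rewrite -invr_gt0.
have dq : 0 < (1 - t) * (q0^-1 - q1^-1) by rewrite mulr_gt0 ?subr_gt0.
have iq_lt : q^-1 < q0^-1 by rewrite hq; lra.
have iq_ge : q1^-1 <= q^-1 by rewrite hq; nra.
(* The relation between the exponents holds at both ends of the segment and is affine, so it
   persists for every [t]. Each pair is then treated directly, without interpolating operators. *)
have hpq : q^-1 = p^-1 - alpha by rewrite hp hq ip1 hq0E; lra.
have p_gt0 : 0 < p by rewrite -invr_gt0; lra.
have p_gt1 : 1 < p by rewrite -[p]invrK invf_gt1 ?invr_gt0//; lra.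
have qq0 : q0 < q by rewrite -ltf_pV2.
have qq1 : q <= q1 by rewrite -lef_pV2.
(* Chosen so that [q = q0 * (1 + s)]; [t < 1] gives [0 < s], and [q <= q1] gives [s <= d], so [w^q]
   satisfies the A_1 condition. *)
pose s := q / q0 - 1.
have s0 : 0 < s by rewrite subr_gt0 ltr_pdivlMr// mul1r.
have sd : s <= d by rewrite lerBlDl ler_pdivrMr// mulrC.
have Ks : 6 * K * s <= 1.
  by rewrite -ler_pdivlMl ?mulr_gt0// mulr1.
have hA' c : nat_A1 (2 * (1 + s) * K) (fun i : nat => w (i%:Z + c) `^ q).
  have := nat_A1_powR s0 (ltW K0) Ks (fun i => powR_gt0 q0 (hw _)) (hK c).
  rewrite /nat_A1 => H a b i hi; have := H a b i hi.
  have qE : q0 * (1 + s) = q by rewrite /s subrKC mulrC divfK// gt_eqF.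
  by under eq_bigr do rewrite -powRrM qE; rewrite -powRrM qE.
have Ks0 : 0 < 2 * (1 + s) * K by rewrite !mulr_gt0// addr_gt0.
have [C C0 HC] := frac_max_strong halpha0 halpha1 Ks0 p_gt1 q_gt0 hpq hw hA'.
by exists C; split=> // x /set_mem; exact: HC.
Qed.
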